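(* Let $g\in\mathscr{L}$, let $\mathbb{A}=(A_1,\ldots,A_n)$ be an $n$-tuple of positive definite matrices in $\mathcal{M}_k$ with $mI\le A_i\le MI$ $(i=1,\ldots,n)$ for some scalars $0<m<M$, and let $w=(w_1,\ldots,w_n)$ be a weight vector. Put $h=\frac{M}{m}$. Then $$\sum_{i=1}^{n}w_iA_i\le K(h,2)\,\sigma_g(w;\mathbb{A}),$$ and $$\sigma_g(w;\mathbb{A})\le K(h,2)\left(\sum_{i=1}^{n}w_iA_i^{-1}\right)^{-1}.$$
   Context: $\mathcal{M}_k$ is the algebra of complex $k\times k$ matrices, $I$ the identity matrix, and $A\le B$ for Hermitian matrices means $B-A$ is positive semidefinite. A weight vector is $w=(w_1,\ldots,w_n)$ with all $w_i>0$ and $\sum_{i=1}^n w_i=1$. $\mathscr{L}$ is the set of all operator monotone functions $g$ on $(0,\infty)$ (real-valued functions, applied to positive definite matrices by functional calculus, with $A\le B\Rightarrow g(A)\le g(B)$ for positive definite matrices of every size) satisfying $g(1)=0$ and $g'(1)=1$. For $g\in\mathscr{L}$, a weight vector $w$ and positive definite $\mathbb{A}=(A_1,\ldots,A_n)$, $\sigma_g(w;\mathbb{A})$ denotes the (unique) positive definite solution $X$ of the generalized Karcher equation $\sum_{i=1}^{n}w_i\,g\left(X^{-1/2}A_iX^{-1/2}\right)=0$. The Kantorovich constant is $K(h,2)=\frac{(h+1)^2}{4h}$. *)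

(* Defs.v *)
From mathcomp Require Import all_boot all_order all_algebra.
From mathcomp Require Import complex.
From mathcomp Require Import reals topology normedtype derive.

Set Implicit Arguments.
Unset Strict Implicit.
Unset Printing Implicit Defensive.

Import Order.TTheory GRing.Theory Num.Theory.
Import numFieldNormedType.Exports.

Local Open Scope ring_scope.
Local Open Scope sesquilinear_scope.
Local Open Scope complex_scope.

(* In R[i], [0 <= z] says that z is real and nonnegative, and likewise for
   [0 < z].  Vectors are rows: v A v^* is the quadratic form of A at the
   column vector v^*. *)
Definition possemidefmx (R : realType) (k : nat) (A : 'M[R[i]]_k) : Prop :=
  A \is hermsymmx /\ forall v : 'rV[R[i]]_k, 0 <= (v *m A *m v ^t*) 0 0.

Definition posdefmx (R : realType) (k : nat) (A : 'M[R[i]]_k) : Prop :=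
  A \is hermsymmx /\
  forall v : 'rV[R[i]]_k, v != 0 -> 0 < (v *m A *m v ^t*) 0 0.

Definition loewner_le (R : realType) (k : nat) (A B : 'M[R[i]]_k) : Prop :=
  possemidefmx (B - A).

(* Functional calculus at a Hermitian matrix A = P^-1 diag(a) P, with P unitary
   and a real: f(A) = P^-1 diag(f(a)) P.  Not meaningful for other matrices. *)
Definition funmx (R : realType) (k : nat) (f : R -> R) (A : 'M[R[i]]_k) :
    'M[R[i]]_k :=
  invmx (spectralmx A)
    *m diag_mx (map_mx (fun z => (f (complex.Re z))%:C) (spectral_diag A))
    *m spectralmx A.

(* Only the values of g on positive reals matter: the spectrum of a positive
   definite matrix lies in (0, +oo). *)
Definition operator_monotone (R : realType) (g : R -> R) : Prop :=
  forall (k : nat) (A B : 'M[R[i]]_k), posdefmx A -> posdefmx B ->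
    loewner_le A B -> loewner_le (funmx g A) (funmx g B).

Definition classL (R : realType) (g : R -> R) : Prop :=
  [/\ operator_monotone g, g 1 = 0 & is_derive (1 : R) (1 : R) g (1 : R)].

Definition weight_vector (R : realType) (n : nat) (w : 'I_n -> R) : Prop :=
  (forall i, 0 < w i) /\ \sum_(i < n) w i = 1.

Definition invsqrtmx (R : realType) (k : nat) (X : 'M[R[i]]_k) : 'M[R[i]]_k :=
  funmx (fun t => (Num.sqrt t)^-1) X.

(* [is_karcher_mean g w A X] says X = sigma_g(w; A). *)
Definition is_karcher_mean (R : realType) (k n : nat) (g : R -> R)
    (w : 'I_n -> R) (A : 'I_n -> 'M[R[i]]_k) (X : 'M[R[i]]_k) : Prop :=
  posdefmx X /\
  \sum_(i < n) (w i)%:C *: funmx g (invsqrtmx X *m A i *m invsqrtmx X) = 0.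

(* K(h, 2) *)
Definition kantorovich2 (R : realType) (h : R) : R := (h + 1) ^+ 2 / (4 * h).

(* Main.v *)
Require Import Defs.
From mathcomp Require Import all_boot all_order all_algebra.
From mathcomp Require Import complex.
From mathcomp Require Import reals.
From mathcomp Require Import classical_sets filter topology normedtype derive.
From mathcomp Require Import ring lra.

(* Operator monotonicity on 2x2 matrices already forces
   1 - 1/t <= g t <= t - 1 for g in L and t > 0: the rotation of diag(t, 1)
   whose (0,0) entry is l t + (1 - l) lies below diag(1 + l v, q) with q large
   if v > t - 1, and above diag(1 + l v, q) with q > 0 small if v < 1 - 1/t and
   l is small.  Comparing (0,0) entries of the images by g bounds l g(t) by
   g(1 + l v) = l v + o(l).
   Applied to the Karcher equation, these bounds put sigma between the weighted
   harmonic and arithmetic means.  With H the mean of the inverses,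
   A + m M A^-1 <= m + M averages to sum_i w_i A_i <= m + M - m M H, and
   m + M <= K Z + m M Z^-1 for every positive definite Z; take Z = sigma, using
   sigma^-1 <= H, and Z = H^-1. *)

Set Implicit Arguments.
Unset Strict Implicit.

Import Order.TTheory GRing.Theory Num.Theory.
Import numFieldNormedType.Exports.

Local Open Scope ring_scope.
Local Open Scope complex_scope.

(** * Positive semidefinite and positive definite matrices: sums, congruences, inverses *)

Section PositiveSemidefinite.

Local Open Scope sesquilinear_scope.
Variable R : realType.
Local Notation C := R[i].

Lemma hermsymmxP k (A : 'M[C]_k) : reflect (A ^t* = A) (A \is hermsymmx).
Proof.
by apply: (iffP (is_hermitianmxP _ _ _)); rewrite expr0 scale1r;
  exact: esym.
Qed.

Lemma trmxC_mul m n p (A : 'M[C]_(m, n)) (B : 'M[C]_(n, p)) :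
  (A *m B) ^t* = B ^t* *m A ^t*.
Proof. by rewrite trmx_mul map_mxM. Qed.

Lemma possemidefmxD k (A B : 'M[C]_k) :
  possemidefmx A -> possemidefmx B -> possemidefmx (A + B).
Proof.
move=> [/hermsymmxP hA pA] [/hermsymmxP hB pB]; split.
  by apply/hermsymmxP; rewrite linearD map_mxD hA hB.
by move=> v; rewrite mulmxDr mulmxDl mxE addr_ge0.
Qed.

Lemma possemidefmxZ k (a : R) (A : 'M[C]_k) :
  0 <= a -> possemidefmx A -> possemidefmx (a%:C *: A).
Proof.
move=> a0 [/hermsymmxP hA pA]; split.
  apply/hermsymmxP; rewrite linearZ map_mxZ hA; congr (_ *: _).
  exact: conjc_real.
by move=> v; rewrite -scalemxAr -scalemxAl mxE mulr_ge0 ?ler0c.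
Qed.

Lemma possemidefmx_sum k n (A : 'I_n -> 'M[C]_k) :
  (forall i, possemidefmx (A i)) -> possemidefmx (\sum_i A i).
Proof.
move=> hA; elim/big_ind: _ => //; last by move=> *; exact: possemidefmxD.
split; first by apply/hermsymmxP; rewrite trmx0 map_mx0.
by move=> v; rewrite mulmx0 mul0mx mxE.
Qed.

Lemma possemidefmx_conj k (A X : 'M[C]_k) :
  possemidefmx A -> possemidefmx (X *m A *m X ^t*).
Proof.
move=> [/hermsymmxP hA pA]; split.
  by apply/hermsymmxP; rewrite !trmxC_mul trmxCK hA !mulmxA.
by move=> v; rewrite -2!mulmxA mulmxA -trmxC_mul mulmxA.
Qed.

Lemma posdefmx_conj k (A X : 'M[C]_k) :
  X \in unitmx -> posdefmx A -> posdefmx (X *m A *m X ^t*).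
Proof.
move=> uX [/hermsymmxP hA pA]; split.
  by apply/hermsymmxP; rewrite !trmxC_mul trmxCK hA !mulmxA.
move=> v v0; rewrite -2!mulmxA mulmxA -trmxC_mul mulmxA; apply: pA.
by apply: contra v0 => /eqP vX; rewrite -(mulmxK uX v) vX mul0mx.
Qed.

Lemma posdefmx_unit k (A : 'M[C]_k) : posdefmx A -> A \in unitmx.
Proof.
move=> [_ pA]; rewrite -row_free_unit; apply/row_freeP.
apply/row_freeP/inj_row_free => v vA; apply/eqP.
by apply/negPn/negP => /pA; rewrite vA mul0mx mxE ltxx.
Qed.

(** The inverse is itself a congruence of [A], by the Hermitian matrix [invmx A]. *)
Lemma posdefmx_inv k (A : 'M[C]_k) : posdefmx A -> posdefmx (invmx A).
Proof.
move=> pA; have uA := posdefmx_unit pA; have [/hermsymmxP hA _] := pA.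
suff <- : invmx A *m A *m (invmx A) ^t* = invmx A.
  by apply: posdefmx_conj; rewrite ?unitmx_inv.
by rewrite mulVmx // mul1mx trmx_inv map_invmx hA.
Qed.

Lemma posdefmx_sum k n (A : 'I_n -> 'M[C]_k) :
  (0 < n)%N -> (forall i, posdefmx (A i)) -> posdefmx (\sum_i A i).
Proof.
case: n A => // n A _ hA; elim: n A hA => [|n IHn] A hA.
  by rewrite big_ord1.
rewrite big_ord_recl; have [/hermsymmxP h0 p0] := hA ord0.
have [/hermsymmxP h1 p1] := IHn (fun i => A (lift ord0 i)) (fun i => hA _).
split; first by apply/hermsymmxP; rewrite linearD map_mxD h0 h1.
by move=> v v0; rewrite mulmxDr mulmxDl mxE addr_gt0 ?p0 ?p1.
Qed.

Lemma posdefmxZ k (a : R) (A : 'M[C]_k) :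
  0 < a -> posdefmx A -> posdefmx (a%:C *: A).
Proof.
move=> a0 [/hermsymmxP hA pA]; split.
  apply/hermsymmxP; rewrite linearZ map_mxZ hA; congr (_ *: _).
  exact: conjc_real.
by move=> v v0; rewrite -scalemxAr -scalemxAl mxE mulr_gt0 ?pA ?(ltcR 0).
Qed.

End PositiveSemidefinite.

(** * Functional calculus of Hermitian matrices *)

Section FunctionalCalculus.

Local Open Scope sesquilinear_scope.
Variable R : realType.
Local Notation C := R[i].

(** The entries of [spectral_diag] are complex in type. For a Hermitian matrix they are real, so the
    real part loses nothing. *)
Definition spec k (A : 'M[C]_k) j : R := complex.Re (spectral_diag A 0 j).

Lemma hermsymmx_spectral k (A : 'M[C]_k) : A \is hermsymmx ->
  A = invmx (spectralmx A)
    *m diag_mx (map_mx (real_complex R) (\row_j spec A j)) *m spectralmx A.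
Proof.
move=> hA; have /hermitian_normalmx /orthomx_spectralP {1}-> := hA.
congr (_ *m diag_mx _ *m _); apply/rowP => j; rewrite !mxE /spec RRe_real //.
exact: (mxOverP (hermitian_spectral_diag_real hA)).
Qed.

Lemma eq_in_funmx k (A : 'M[C]_k) (f f' : R -> R) :
  (forall j, f (spec A j) = f' (spec A j)) -> funmx f A = funmx f' A.
Proof.
move=> ff'; congr (_ *m diag_mx _ *m _).
by apply/rowP => j; rewrite !mxE; congr _%:C; exact: ff'.
Qed.

Lemma funmx_id k (A : 'M[C]_k) : A \is hermsymmx -> funmx id A = A.
Proof.
move=> hA; rewrite [RHS](hermsymmx_spectral hA).
by congr (_ *m diag_mx _ *m _); apply/rowP => j; rewrite !mxE.
Qed.

Lemma funmx_cst k (A : 'M[C]_k) (c : R) : funmx (fun=> c) A = c%:C%:M.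
Proof.
rewrite /funmx (_ : map_mx _ _ = const_mx c%:C) ?diag_const_mx.
  by rewrite mul_mx_scalar -scalemxAl mulVmx ?spectral_unit // scalemx1.
by apply/rowP => j; rewrite !mxE.
Qed.

Lemma funmxD k (A : 'M[C]_k) (f f' : R -> R) :
  funmx (fun t => f t + f' t) A = funmx f A + funmx f' A.
Proof.
rewrite /funmx -mulmxDl -mulmxDr -linearD /=; congr (_ *m diag_mx _ *m _).
by apply/rowP => j; rewrite !mxE rmorphD.
Qed.

Lemma funmxM k (A : 'M[C]_k) (f f' : R -> R) :
  funmx (fun t => f t * f' t) A = funmx f A *m funmx f' A.
Proof.
rewrite /funmx !mulmxA mulmxK ?spectral_unit // -[X in _ = X *m _]mulmxA.
rewrite mulmx_diag; congr (_ *m diag_mx _ *m _).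
by apply/rowP => j; rewrite !mxE rmorphM.
Qed.

Lemma funmxZ k (A : 'M[C]_k) (c : R) (f : R -> R) :
  funmx (fun t => c * f t) A = c%:C *: funmx f A.
Proof. by rewrite funmxM funmx_cst mul_scalar_mx. Qed.

Lemma possemidefmx_diag k (d : 'rV[R]_k) : (forall j, 0 <= d 0 j) ->
  possemidefmx (diag_mx (map_mx (real_complex R) d)).
Proof.
move=> d0; split.
  apply/hermsymmxP; rewrite tr_diag_mx map_diag_mx; congr diag_mx.
  by apply/rowP => j; rewrite !mxE; exact: conjc_real.
move=> v; rewrite mxE sumr_ge0 // => j _.
rewrite mul_mx_diag !mxE mulrAC mulr_ge0 ?ler0c //.
exact: mul_conjC_ge0.
Qed.

(** [spectralmx A] is unitary, so [funmx f A] is a congruence of a nonnegative diagonal matrix.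
    Scalar inequalities on the spectrum become matrix inequalities through this lemma. *)
Lemma possemidefmx_funmx k (A : 'M[C]_k) (f : R -> R) :
  (forall j, 0 <= f (spec A j)) -> possemidefmx (funmx f A).
Proof.
move=> f0; have uP := spectral_unitarymx A.
rewrite /funmx invmx_unitary // -{2}[spectralmx A]trmxCK.
apply: possemidefmx_conj.
rewrite (_ : map_mx _ _ = map_mx (real_complex R) (\row_j f (spec A j))).
  by apply: possemidefmx_diag => j; rewrite mxE.
by apply/rowP => j; rewrite !mxE.
Qed.

Lemma funmx_hermsymmx k (A : 'M[C]_k) (f : R -> R) : funmx f A ^t* = funmx f A.
Proof.
have uP := spectral_unitarymx A.
rewrite /funmx invmx_unitary // !trmxC_mul trmxCK !mulmxA.
congr (_ *m _ *m _); rewrite tr_diag_mx map_diag_mx; congr diag_mx.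
by apply/rowP => j; rewrite !mxE; exact: conjc_real.
Qed.

(** The rows of [spectralmx A] are unit eigenvectors. Testing a quadratic form on them turns matrix
    inequalities into bounds on eigenvalues. *)
Lemma spec_form k (A : 'M[C]_k) j : A \is hermsymmx ->
  exists2 v : 'rV[C]_k, v *m v ^t* = 1%:M & v *m A *m v ^t* = (spec A j)%:C%:M.
Proof.
move=> hA; have uP := spectral_unitarymx A; exists (row j (spectralmx A)).
  apply/matrixP => a b; rewrite !ord1.
  have /unitarymxP/matrixP/(_ j j) := uP; rewrite !mxE eqxx => <-.
  by apply: eq_bigr => i _; rewrite !mxE.
have E : spectralmx A *m A *m (spectralmx A)^t*
         = diag_mx (map_mx (real_complex R) (\row_j spec A j)).
  rewrite {2}(hermsymmx_spectral hA) -mulmxA mulmxtVK // mulKVmx //.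
  exact: spectral_unit.
apply/matrixP => a b; rewrite !ord1.
have /matrixP/(_ j j) := E; rewrite [RHS]mxE !mxE eqxx mulr1n => <-.
apply: eq_bigr => i _; rewrite -row_mul !mxE; congr (_ * _).
Qed.

Lemma posdefmx_spec_gt0 k (A : 'M[C]_k) j : posdefmx A -> 0 < spec A j.
Proof.
move=> [hA pA]; have [v v1 vA] := spec_form j hA.
rewrite -(ltcR 0); have := pA v; rewrite vA mxE mulr1n; apply.
apply/eqP => v0; move: v1; rewrite v0 mul0mx => /matrixP/(_ 0 0).
by rewrite !mxE => /esym/eqP; rewrite oner_eq0.
Qed.

Lemma spec_ge k (A : 'M[C]_k) (m : R) j : A \is hermsymmx ->
  loewner_le m%:C%:M A -> m <= spec A j.
Proof.
move=> hA [_ /=]; have [v v1 vA] := spec_form j hA.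
move=> /(_ v); rewrite mulmxBr mulmxBl vA mul_mx_scalar -scalemxAl v1.
by rewrite !mxE !mulr1n mulr1 -rmorphB ler0c subr_ge0.
Qed.

Lemma spec_le k (A : 'M[C]_k) (m : R) j : A \is hermsymmx ->
  loewner_le A m%:C%:M -> spec A j <= m.
Proof.
move=> hA [_ /=]; have [v v1 vA] := spec_form j hA.
move=> /(_ v); rewrite mulmxBr mulmxBl vA mul_mx_scalar -scalemxAl v1.
by rewrite !mxE !mulr1n mulr1 -rmorphB ler0c subr_ge0.
Qed.

(** On a positive spectrum [t^-1 * t] is the constant 1, so multiplicativity of the calculus yields
    a left inverse of [A]. *)
Lemma funmx_inv k (A : 'M[C]_k) : posdefmx A -> funmx GRing.inv A = invmx A.
Proof.
move=> pA; have uA := posdefmx_unit pA; have [hA _] := pA.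
rewrite -[LHS](mulmxK uA) -{2}(funmx_id hA) -funmxM.
rewrite (@eq_in_funmx _ _ _ (fun=> 1)) ?funmx_cst ?mul1mx // => j.
by rewrite mulVf // gt_eqF // posdefmx_spec_gt0.
Qed.

Lemma funmx_laurent k (A : 'M[C]_k) (a b c : R) : posdefmx A ->
  funmx (fun t => a * t + b * t^-1 + c) A
  = a%:C *: A + b%:C *: invmx A + c%:C%:M.
Proof.
move=> pA; rewrite 2!funmxD !funmxZ funmx_cst funmx_inv //.
by rewrite funmx_id //; case: pA.
Qed.

(* If W intertwines two diagonal matrices, then W i j <> 0 forces the i-th and
   j-th diagonal entries to agree, so W also intertwines their images by f. *)
Lemma funmx_diagonalized k (f : R -> R) (P : 'M[C]_k) (d : 'rV[R]_k) :
  P \in unitmx ->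
  invmx P *m diag_mx (map_mx (real_complex R) d) *m P \is hermsymmx ->
  funmx f (invmx P *m diag_mx (map_mx (real_complex R) d) *m P)
  = invmx P *m diag_mx (map_mx (real_complex R) (map_mx f d)) *m P.
Proof.
move=> uP; set A := _ *m P => hA; set Q := spectralmx A.
have uQ : Q \in unitmx := spectral_unit A.
pose W := P *m invmx Q.
have E : diag_mx (map_mx (real_complex R) d) *m W
         = W *m diag_mx (map_mx (real_complex R) (\row_j spec A j)).
  rewrite /W; apply: (can_inj (mulmxK uQ)); rewrite !mulmxA mulmxKV //.
  rewrite -[X in _ = X *m Q]mulmxA -[RHS]mulmxA -(hermsymmx_spectral hA).
  by rewrite /A !mulmxA mulmxV // mul1mx.
have intertwine (V : 'M[C]_k) :
    diag_mx (map_mx (real_complex R) d) *m V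
      = V *m diag_mx (map_mx (real_complex R) (\row_j spec A j)) ->
    diag_mx (map_mx (real_complex R) (map_mx f d)) *m V
      = V *m diag_mx (map_mx (real_complex R) (\row_j f (spec A j))).
  move=> /matrixP VE; apply/matrixP => a b; have := VE a b.
  rewrite !mul_diag_mx !mul_mx_diag !mxE ![_ * V a b]mulrC.
  have [->|V0] := eqVneq (V a b) 0; first by rewrite !mul0r.
  by move=> /(mulfI V0) [->].
have {intertwine E} F := intertwine _ E.
have -> : funmx f A
    = invmx Q *m diag_mx (map_mx (real_complex R) (\row_j f (spec A j))) *m Q.
  by congr (_ *m diag_mx _ *m _); apply/rowP => j; rewrite !mxE.
apply: (can_inj (mulKmx uP)); rewrite !mulmxA mulmxV // mul1mx.
have uQV : invmx Q \in unitmx by rewrite unitmx_inv.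
by apply: (can_inj (mulmxK uQV)); move: F; rewrite /W !mulmxA mulmxK.
Qed.

End FunctionalCalculus.

(** * Real symmetric 2x2 matrices and their rotations *)

Section TwoByTwo.

Local Open Scope sesquilinear_scope.
Variable R : realType.
Local Notation C := R[i].

(** Indexing by [i + j] puts [b] at both off-diagonal places and reduces symmetry to commutativity
    of addition. *)
Definition sym2 (a b e : R) : 'M[R]_2 :=
  \matrix_(i, j) ([:: a; b; e]`_(i + j)).

Lemma hermsymmx_sym2 a b e : map_mx (real_complex R) (sym2 a b e) \is hermsymmx.
Proof.
apply/hermsymmxP/matrixP => i j; rewrite !mxE addnC; exact: conjc_real.
Qed.

(** With real symmetric coefficients the cross terms between real and imaginary parts cancel, so the
    form splits into two copies of the real quadratic form. *)
Lemma sym2_form a b e (v : 'rV[C]_2) :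
  (v *m map_mx (real_complex R) (sym2 a b e) *m v ^t*) 0 0 =
  (a * complex.Re (v 0 0) ^+ 2
   + b * complex.Re (v 0 0) * complex.Re (v 0 1) *+ 2
   + e * complex.Re (v 0 1) ^+ 2
   + (a * complex.Im (v 0 0) ^+ 2
      + b * complex.Im (v 0 0) * complex.Im (v 0 1) *+ 2
      + e * complex.Im (v 0 1) ^+ 2))%:C.
Proof.
rewrite !mxE !big_ord_recl !big_ord0 !mxE !big_ord_recl !big_ord0 !mxE.
rewrite (_ : lift ord0 ord0 = 1); last exact: val_inj.
rewrite (_ : ord0 = 0) //=.
case: (v 0 0) => p q; case: (v 0 1) => r t; rewrite /real_complex_def.
by apply/eqP; rewrite eq_complex; apply/andP; split; apply/eqP => /=; ring.
Qed.

Lemma sym2_real_form_ge0 (a b e p q : R) : 0 < a -> b ^+ 2 <= a * e ->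
  0 <= a * p ^+ 2 + b * p * q *+ 2 + e * q ^+ 2.
Proof.
move=> a0 h; rewrite -(pmulr_rge0 _ a0).
have -> : a * (a * p ^+ 2 + b * p * q *+ 2 + e * q ^+ 2)
  = (a * p + b * q) ^+ 2 + (a * e - b ^+ 2) * q ^+ 2 by ring.
by rewrite addr_ge0 ?sqr_ge0 // mulr_ge0 ?sqr_ge0 ?subr_ge0.
Qed.

Lemma sym2_real_form_gt0 (a b e p q : R) : 0 < a -> b ^+ 2 < a * e ->
  (p != 0) || (q != 0) -> 0 < a * p ^+ 2 + b * p * q *+ 2 + e * q ^+ 2.
Proof.
move=> a0 h pq; rewrite -(pmulr_rgt0 _ a0).
have -> : a * (a * p ^+ 2 + b * p * q *+ 2 + e * q ^+ 2)
  = (a * p + b * q) ^+ 2 + (a * e - b ^+ 2) * q ^+ 2 by ring.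
have [q0|q0] := eqVneq q 0.
  rewrite q0 mulr0 addr0 expr0n mulr0 addr0 exprn_even_gt0 //=.
  by move: pq; rewrite q0 eqxx orbF mulf_eq0 (gt_eqF a0).
by rewrite ltr_wpDl ?sqr_ge0 // mulr_gt0 ?subr_gt0 // exprn_even_gt0.
Qed.

Lemma possemidefmx_sym2 a b e : 0 < a -> b ^+ 2 <= a * e ->
  possemidefmx (map_mx (real_complex R) (sym2 a b e)).
Proof.
move=> a0 h; split; first exact: hermsymmx_sym2.
by move=> v; rewrite sym2_form ler0c addr_ge0 ?sym2_real_form_ge0.
Qed.

Lemma posdefmx_sym2 a b e : 0 < a -> b ^+ 2 < a * e ->
  posdefmx (map_mx (real_complex R) (sym2 a b e)).
Proof.
move=> a0 h; split; first exact: hermsymmx_sym2.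
move=> v v0; rewrite sym2_form (ltcR 0).
(* A nonzero [v] has a nonzero real or imaginary part. That part contributes a positive value and
   the other a nonnegative one. *)
have [re0|re0] :=
  boolP ((complex.Re (v 0 0) != 0) || (complex.Re (v 0 1) != 0)).
  by rewrite ltr_wpDr ?sym2_real_form_gt0 ?sym2_real_form_ge0 // ltW.
rewrite ltr_wpDl ?sym2_real_form_gt0 ?sym2_real_form_ge0 // ?ltW //.
apply: contraT; rewrite negb_or !negbK => im0.
move: re0 v0; rewrite negb_or !negbK => re0 /eqP[].
apply/rowP => j; rewrite mxE.
move: im0 re0; case: j => [[|[|//]] lt_j].
  rewrite (_ : Ordinal _ = 0); last exact: val_inj.
  by case: (v 0 0) => x y /= /andP[/eqP-> _] /andP[/eqP-> _].
rewrite (_ : Ordinal _ = 1); last exact: val_inj.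
by case: (v 0 1) => x y /= /andP[_ /eqP->] /andP[_ /eqP->].
Qed.

(* The matrix with eigenvalue x on (c, s) and eigenvalue y on (-s, c). *)
Definition rot2 (c s x y : R) : 'M[R]_2 :=
  sym2 (c ^+ 2 * x + s ^+ 2 * y) (c * s * (x - y)) (s ^+ 2 * x + c ^+ 2 * y).

(** Diagonalizing by the rotation [P] with rows [(c, s)] and [(-s, c)], [funmx_diagonalized] lets
    [f] act on the eigenvalues and leaves the rotation fixed. *)
Lemma funmx_rot2 (f : R -> R) (c s x y : R) : c ^+ 2 + s ^+ 2 = 1 ->
  funmx f (map_mx (real_complex R) (rot2 c s x y))
  = map_mx (real_complex R) (rot2 c s (f x) (f y)).
Proof.
move=> cs1; pose P : 'M[R]_2 :=
  \matrix_(i, j) (if i == j then c else if i == 0 then s else - s).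
have PT1 : P^T *m P = 1%:M.
  apply/matrixP => -[[|[|//]] ?] -[[|[|//]] ?];
    rewrite !mxE !big_ord_recl big_ord0 !mxE /= ?mulr1n ?mulr0n; nra.
have uP : P \in unitmx by have [] := mulmx1_unit PT1.
have iP : invmx P = P^T.
  by rewrite -[LHS]mul1mx -PT1 mulmxK.
have rotE a b : map_mx (real_complex R) (rot2 c s a b) =
    invmx (map_mx (real_complex R) P)
    *m diag_mx (map_mx (real_complex R) (\row_j (if j == 0 then a else b)))
    *m map_mx (real_complex R) P.
  rewrite -map_invmx -map_diag_mx -!map_mxM iP; congr map_mx.
  apply/matrixP => i j; rewrite mul_mx_diag !mxE !big_ord_recl big_ord0 !mxE.
  by case: i => [[|[|//]] ?]; case: j => [[|[|//]] ?] /=; ring.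
rewrite [in LHS]rotE funmx_diagonalized ?map_unitmx -?rotE ?hermsymmx_sym2 //.
rewrite rotE; congr (_ *m diag_mx _ *m _); congr map_mx.
by apply/rowP => j; rewrite !mxE; case: ifP.
Qed.

End TwoByTwo.

(** * Scalar bounds forced by operator monotonicity *)

Section ScalarBounds.

Local Open Scope sesquilinear_scope.
Variable R : realType.
Local Notation C := R[i].

Lemma possemidefmx_diag_ge0 k (A : 'M[C]_k) i : possemidefmx A -> 0 <= A i i.
Proof.
move=> [_ /(_ (delta_mx 0 i))]; rewrite -rowE.
rewrite mxE (bigD1 i) //= big1 => [|j ji]; rewrite !mxE eqxx.
  by rewrite addr0 eqxx rmorph1 mulr1.
by rewrite (negbTE ji) rmorph0 mulr0.
Qed.

Lemma loewner_le_sym2 (a b e a' b' e' : R) : a < a' ->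
  (b' - b) ^+ 2 <= (a' - a) * (e' - e) ->
  loewner_le (map_mx (real_complex R) (sym2 a b e))
             (map_mx (real_complex R) (sym2 a' b' e')).
Proof.
move=> aa' h; rewrite /loewner_le -map_mxB.
rewrite (_ : _ - _ = sym2 (a' - a) (b' - b) (e' - e)).
  by apply: possemidefmx_sym2; rewrite ?subr_gt0.
apply/matrixP => i j; rewrite !mxE.
by case: i => [[|[|//]] ?]; case: j => [[|[|//]] ?].
Qed.

(** Seen as a trivial rotation, a diagonal matrix also falls under [funmx_rot2]. *)
Lemma rot210 (x y : R) : rot2 1 0 x y = sym2 x 0 y.
Proof. by rewrite /rot2; congr sym2; ring. Qed.

(** Only the [(0, 0)] entries of the two images by [g] are compared, so [q] disappears from the
    conclusion and may be chosen freely to secure the hypothesis. *)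
Lemma operator_monotone_rot2_le (g : R -> R) (c s x y p q : R) :
  operator_monotone g -> c ^+ 2 + s ^+ 2 = 1 ->
  posdefmx (map_mx (real_complex R) (rot2 c s x y)) -> 0 < p -> 0 < q ->
  loewner_le (map_mx (real_complex R) (rot2 c s x y))
             (map_mx (real_complex R) (sym2 p 0 q)) ->
  c ^+ 2 * g x + s ^+ 2 * g y <= g p.
Proof.
move=> mg cs1 pos p0 q0.
have posB : posdefmx (map_mx (real_complex R) (sym2 p 0 q)).
  by apply: posdefmx_sym2; rewrite // expr0n mulr_gt0.
move=> /(mg _ _ _ pos posB) /(possemidefmx_diag_ge0 0).
rewrite -rot210 !funmx_rot2 // ?expr1n ?expr0n ?addr0 // rot210 !mxE /=.
by rewrite -rmorphB ler0c subr_ge0.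
Qed.

Lemma operator_monotone_rot2_ge (g : R -> R) (c s x y p q : R) :
  operator_monotone g -> c ^+ 2 + s ^+ 2 = 1 ->
  posdefmx (map_mx (real_complex R) (rot2 c s x y)) -> 0 < p -> 0 < q ->
  loewner_le (map_mx (real_complex R) (sym2 p 0 q))
             (map_mx (real_complex R) (rot2 c s x y)) ->
  g p <= c ^+ 2 * g x + s ^+ 2 * g y.
Proof.
move=> mg cs1 pos p0 q0.
have posB : posdefmx (map_mx (real_complex R) (sym2 p 0 q)).
  by apply: posdefmx_sym2; rewrite // expr0n mulr_gt0.
move=> /(mg _ _ _ posB pos) /(possemidefmx_diag_ge0 0).
rewrite -rot210 !funmx_rot2 // ?expr1n ?expr0n ?addr0 // rot210 !mxE /=.
by rewrite -rmorphB ler0c subr_ge0.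
Qed.

Lemma posdefmx_rot2 (c s x y : R) : c ^+ 2 + s ^+ 2 = 1 -> 0 < x -> 0 < y ->
  posdefmx (map_mx (real_complex R) (rot2 c s x y)).
Proof.
move=> cs1 x0 y0; apply: posdefmx_sym2.
  move: (cs1); have [->|c0 _] := eqVneq c 0.
    by rewrite expr0n add0r => ->; rewrite mul0r add0r mul1r.
  apply: ltr_wpDr; first by rewrite mulr_ge0 ?sqr_ge0 ?ltW.
  by rewrite mulr_gt0 // exprn_even_gt0.
(* The determinant is the product of the eigenvalues, up to the factor [(c ^+ 2 + s ^+ 2) ^+ 2],
   which is 1. *)
rewrite -subr_gt0 (_ : _ - _ = (c ^+ 2 + s ^+ 2) ^+ 2 * (x * y)); last ring.
by rewrite cs1 expr1n mul1r mulr_gt0.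
Qed.

Lemma operator_monotone_arith (g : R -> R) (x l p : R) :
  operator_monotone g -> g 1 = 0 -> 0 < x -> 0 < l -> l < 1 ->
  l * x + (1 - l) < p -> l * g x <= g p.
Proof.
move=> mg g1 x0 l0 l1 hp.
pose c := Num.sqrt l; pose s := Num.sqrt (1 - l).
have c2 : c ^+ 2 = l by rewrite sqr_sqrtr ?ltW.
have s2 : s ^+ 2 = 1 - l by rewrite sqr_sqrtr ?subr_ge0 ?ltW.
have cs1 : c ^+ 2 + s ^+ 2 = 1 by rewrite c2 s2; ring.
pose a := l * x + (1 - l); pose e := (1 - l) * x + l.
have a0 : 0 < a by rewrite addr_gt0 ?mulr_gt0 ?subr_gt0.
have e0 : 0 < e by rewrite addr_gt0 ?mulr_gt0 ?subr_gt0.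
have pa : 0 < p - a by rewrite subr_gt0.
(* [a] and [e] are the diagonal entries of the rotation of diag(x, 1), and [d] is the square of its
   off-diagonal entry. *)
pose d := l * (1 - l) * (x - 1) ^+ 2.
have d0 : 0 <= d.
  by rewrite mulr_ge0 ?sqr_ge0 // mulr_ge0 ?subr_ge0 // ltW.
(* det (diag(p, q) - A) = 0, where A is the rotation of diag(x, 1). *)
pose q := e + d / (p - a).
have q0 : 0 < q by rewrite ltr_wpDr // divr_ge0 // ltW.
suff : c ^+ 2 * g x + s ^+ 2 * g 1 <= g p by rewrite c2 g1 mulr0 addr0.
apply: (@operator_monotone_rot2_le g c s x 1 p q) => //.
- exact: posdefmx_rot2.
- exact: lt_trans hp.
rewrite /rot2 c2 s2 !mulr1; apply: loewner_le_sym2 => //.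
rewrite sub0r sqrrN !exprMn c2 s2 -/a -/e /q (addrC e) addrK.
by rewrite -/d mulrCA mulfV ?gt_eqF // mulr1.
Qed.

(** Let A be the rotation of diag(x, 1), with diagonal entries [a], [e] and determinant [x].
    Lowering its [(0, 0)] entry by [p] leaves the determinant [x - p * e], positive by hypothesis,
    so some diag(p, q) with [q] positive still lies below A. *)
Lemma operator_monotone_harm (g : R -> R) (x l p : R) :
  operator_monotone g -> g 1 = 0 -> 0 < x -> 0 < l -> l < 1 -> 0 < p ->
  p * ((1 - l) * x + l) < x -> g p <= l * g x.
Proof.
move=> mg g1 x0 l0 l1 p0 hp.
pose c := Num.sqrt l; pose s := Num.sqrt (1 - l).
have c2 : c ^+ 2 = l by rewrite sqr_sqrtr ?ltW.
have s2 : s ^+ 2 = 1 - l by rewrite sqr_sqrtr ?subr_ge0 ?ltW.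
have cs1 : c ^+ 2 + s ^+ 2 = 1 by rewrite c2 s2; ring.
pose a := l * x + (1 - l); pose e := (1 - l) * x + l.
have a0 : 0 < a by rewrite addr_gt0 ?mulr_gt0 ?subr_gt0.
have e0 : 0 < e by rewrite addr_gt0 ?mulr_gt0 ?subr_gt0.
pose d := l * (1 - l) * (x - 1) ^+ 2.
have d0 : 0 <= d.
  by rewrite mulr_ge0 ?sqr_ge0 // mulr_ge0 ?subr_ge0 // ltW.
have det : a * e - d = x by rewrite /a /e /d; ring.
have dlt : d < (a - p) * e by rewrite -/e in hp; lra.
have pa : 0 < a - p by rewrite -(pmulr_lgt0 _ e0); apply: le_lt_trans dlt.
(* This value of [q] makes the determinant of A - diag(p, q) vanish. It must be positive for
   monotonicity of [g] to apply. *)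
have q0 : 0 < e - d / (a - p).
  by rewrite subr_gt0 ltr_pdivrMr // mulrC.
suff : g p <= c ^+ 2 * g x + s ^+ 2 * g 1 by rewrite c2 g1 mulr0 addr0.
apply: (@operator_monotone_rot2_ge g c s x 1 p (e - d / (a - p))) => //.
  exact: posdefmx_rot2.
rewrite /rot2 c2 s2 !mulr1; apply: loewner_le_sym2; first by rewrite -subr_gt0.
rewrite subr0 !exprMn c2 s2 subKr.
by rewrite -/d mulrCA mulfV ?gt_eqF // mulr1.
Qed.

(** This is the expansion g(1 + l v) = l v + o(l) as l decreases to 0, from g(1) = 0 and g'(1) =
    1. *)
Lemma derive1_approx (g : R -> R) (v eps : R) :
  is_derive (1 : R) (1 : R) g (1 : R) -> g 1 = 0 -> 0 < eps ->
  exists2 d : R, 0 < d &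
    forall l : R, 0 < l -> l < d -> `|g (1 + l * v) - l * v| <= l * eps.
Proof.
move=> [dg dg1] g1 e0.
(* The difference quotient is taken at the increment [l * v], which has to be nonzero. *)
have [->|v0] := eqVneq v 0.
  by exists 1 => // l l0 _; rewrite mulr0 addr0 g1 subrr normr0 mulr_ge0 // ltW.
(* An error [eps / |v|] on the quotient becomes [l * eps] after multiplication by the absolute value
   of [l * v]. *)
have e'0 : 0 < eps / `|v| by rewrite divr_gt0 ?normr_gt0.
have : ((fun h => h^-1 *: (g (h *: 1 + 1) - g 1)) @ 0^' --> 'D_1 g 1)%classic
  by exact: dg.
rewrite dg1 => /cvgrPdist_le /(_ _ e'0); rewrite near_withinE => -[d /= d0 hd].
exists (d / `|v|); first by rewrite divr_gt0 ?normr_gt0.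
move=> l l0 ld; have lv0 : l * v != 0 by rewrite mulf_neq0 // gt_eqF.
have := hd (l * v); rewrite /ball /= sub0r normrN normrM (gtr0_norm l0).
rewrite -ltr_pdivlMr ?normr_gt0 // => /(_ ld lv0).
rewrite g1 subr0 /GRing.scale /= mulr1 (addrC _ 1) => h.
rewrite distrC -(ler_pM2r (_ : 0 < `|l * v|^-1)); last first.
  by rewrite invr_gt0 normr_gt0.
rewrite -normfV -normrM mulrBl mulfV // (mulrC (g _)).
apply: (le_trans h); rewrite normfV normrM (gtr0_norm l0).
by rewrite invfM mulrACA mulfV ?gt_eqF // mul1r.
Qed.

(** Take p = 1 + l (x - 1 + eps/2), just above the [(0, 0)] entry 1 + l (x - 1). Then l g(x) <= g(p)
    <= l (x - 1 + eps), and l cancels. *)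
Lemma classL_le (g : R -> R) (x : R) : classL g -> 0 < x -> g x <= x - 1.
Proof.
move=> [mg g1 dg] x0; apply/ler_addgt0Pr => eps eps0.
have e20 : 0 < eps / 2 by rewrite divr_gt0.
have [d d0 hd] := derive1_approx (x - 1 + eps / 2) dg g1 e20.
pose l := Num.min (d / 2) (1 / 2).
have l0 : 0 < l by rewrite lt_min !divr_gt0.
have ld : l < d by rewrite gt_min; apply/orP; left; lra.
have l1 : l < 1 by rewrite gt_min; apply/orP; right; lra.
have := hd l l0 ld; rewrite ler_norml => /andP[_].
have lp : l * x + (1 - l) < 1 + l * (x - 1 + eps / 2) by nra.
have := operator_monotone_arith mg g1 x0 l0 l1 lp.
move=> h1 h2; rewrite -(ler_pM2l l0); lra.
Qed.

(** With v = 1 - 1/x - eps/2 and l small, l v - l eps/2 <= g(1 + l v) <= l g(x). Cancelling l gives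
    1 - 1/x - eps <= g(x). *)
Lemma classL_ge (g : R -> R) (x : R) : classL g -> 0 < x -> 1 - x^-1 <= g x.
Proof.
move=> [mg g1 dg] x0; apply/ler_addgt0Pr => eps eps0.
have e20 : 0 < eps / 2 by rewrite divr_gt0.
pose v := 1 - x^-1 - eps / 2.
have vx : v * x = x - 1 - eps / 2 * x.
  by rewrite /v !mulrBl mulVf ?gt_eqF ?mul1r.
have [d d0 hd] := derive1_approx v dg g1 e20.
(* [r1] keeps p = 1 + l v positive. [r2] comes from x - p ((1 - l) x + l) = l (l v (x - 1) + x
   eps/2), which has to be positive. The added 1 keeps both denominators nonzero. *)
pose r1 := (`|v| + 1)^-1; pose r2 := eps / 2 * x / (`|v * (x - 1)| + 1).
have r1_gt0 : 0 < r1 by rewrite invr_gt0 ltr_wpDl ?normr_ge0.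
have r2_gt0 : 0 < r2 by apply: divr_gt0; [exact: mulr_gt0|rewrite ltr_wpDl].
pose l := Num.min (Num.min d 1) (Num.min r1 r2) / 2.
have l0 : 0 < l by rewrite divr_gt0 // !lt_min d0 r1_gt0 r2_gt0 ltr01.
have : l < Num.min (Num.min d 1) (Num.min r1 r2).
  by rewrite /l; move: l0; rewrite /l; lra.
rewrite !lt_min => /andP[/andP[ld l1] /andP[lr1 lr2]].
have lv : l * `|v| < 1.
  by move: lr1; rewrite /r1 -div1r ltr_pdivlMr ?ltr_wpDl // mulrDr; lra.
have lvx : l * `|v * (x - 1)| < eps / 2 * x.
  move: lr2; rewrite ltr_pdivlMr ?ltr_wpDl //; rewrite mulrDr; lra.
have p0 : 0 < 1 + l * v.
  have : - `|v| <= v by rewrite lerNl ler_normr lexx orbT.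
  by move=> /(ler_wpM2l (ltW l0)); lra.
have ph : (1 + l * v) * ((1 - l) * x + l) < x.
  have : - `|v * (x - 1)| <= v * (x - 1) by rewrite lerNl ler_normr lexx orbT.
  move=> /(ler_wpM2l (ltW l0)) h.
  have y0 : 0 < l * (v * (x - 1)) + eps / 2 * x.
    by rewrite -(opprK (l * _)) addrC subr_gt0 (le_lt_trans _ lvx) //
      lerNl -mulrN.
  have : 0 < l * (l * (v * (x - 1)) + eps / 2 * x) by rewrite mulr_gt0.
  by rewrite -subr_gt0; congr (0 < _); ring: vx.
have gv_le := operator_monotone_harm mg g1 x0 l0 l1 p0 ph.
have := hd l l0 ld; rewrite ler_norml => /andP[+ _].
rewrite lerBrDr addrC => gv_ge.
have : l * v <= l * (g x + eps / 2).
  by rewrite (mulrDr l (g x)) -lerBlDr; exact: le_trans gv_le.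
by rewrite (ler_pM2l l0) /v; lra.
Qed.

End ScalarBounds.

(** * The Karcher mean between the weighted harmonic and arithmetic means *)

Section KarcherMean.

Local Open Scope sesquilinear_scope.
Variable R : realType.
Local Notation C := R[i].

Lemma classL_psd_arith (k : nat) (g : R -> R) (Y : 'M[C]_k) :
  classL g -> posdefmx Y -> possemidefmx (Y - 1%:M - funmx g Y).
Proof.
move=> Lg pY; have [hY _] := pY.
suff -> : Y - 1%:M - funmx g Y
    = funmx (fun t => (t + (-1)) + (-1) * g t) Y.
  apply: possemidefmx_funmx => j.
  have := classL_le Lg (posdefmx_spec_gt0 j pY); lra.
rewrite funmxD (funmxD Y id) funmxZ funmx_cst funmx_id //.
by rewrite rmorphN1 scaleN1r raddfN.
Qed.

Lemma classL_psd_harm (k : nat) (g : R -> R) (Y : 'M[C]_k) :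
  classL g -> posdefmx Y -> possemidefmx (invmx Y - 1%:M + funmx g Y).
Proof.
move=> Lg pY; have [hY _] := pY.
suff -> : invmx Y - 1%:M + funmx g Y
    = funmx (fun t => (t^-1 + (-1)) + g t) Y.
  apply: possemidefmx_funmx => j.
  have := classL_ge Lg (posdefmx_spec_gt0 j pY); lra.
rewrite funmxD (funmxD Y GRing.inv) funmx_cst funmx_inv //.
by rewrite rmorphN1 raddfN.
Qed.

Lemma sum_weights_scalar (n k : nat) (w : 'I_n -> R) (B : 'M[C]_k) :
  \sum_i w i = 1 -> \sum_i (w i)%:C *: B = B.
Proof. by move=> w1; rewrite -scaler_suml -rmorph_sum w1 scale1r. Qed.

Lemma invmx_congr k (T Q A : 'M[C]_k) :
  T *m Q = 1%:M -> A \in unitmx -> invmx (T *m A *m T) = Q *m invmx A *m Q.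
Proof.
move=> TQ uA; have [uT uQ] := mulmx1_unit TQ.
have YZ : (T *m A *m T) *m (Q *m invmx A *m Q) = 1%:M.
  by rewrite !mulmxA -(mulmxA (T *m A)) TQ mulmx1 mulmxK.
have [uY _] := mulmx1_unit YZ.
by rewrite -[LHS]mulmx1 -YZ mulKmx.
Qed.

(** The witness is the square root of [S]. These algebraic relations are all that is used later, so
    [invsqrtmx S] can then be generalized to a variable [T]. *)
Lemma ex_sqrtmx k (S : 'M[C]_k) (T := invsqrtmx S) : posdefmx S ->
  exists Q : 'M[C]_k,
    [/\ T ^t* = T, Q ^t* = Q, T *m Q = 1%:M, Q *m Q = S & T *m T = invmx S].
Proof.
move=> pS; have [hS _] := pS; exists (funmx Num.sqrt S).
split; rewrite ?/T ?/invsqrtmx ?funmx_hermsymmx // -funmxM.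
- transitivity (funmx (fun=> 1) S); last exact: funmx_cst.
  apply: eq_in_funmx => j.
  by rewrite mulVf // gt_eqF // sqrtr_gt0 posdefmx_spec_gt0.
- transitivity (funmx id S); last exact: funmx_id.
  apply: eq_in_funmx => j.
  by rewrite -expr2 sqr_sqrtr // ltW // posdefmx_spec_gt0.
- transitivity (funmx GRing.inv S); last exact: funmx_inv.
  apply: eq_in_funmx => j.
  by rewrite -invfM -expr2 sqr_sqrtr // ltW // posdefmx_spec_gt0.
Qed.

Variables (k n : nat) (g : R -> R) (w : 'I_n -> R) (A : 'I_n -> 'M[C]_k).
Variable S : 'M[C]_k.
Hypotheses (Lg : classL g) (pA : forall i, posdefmx (A i)).
Hypotheses (hw : weight_vector w) (hS : is_karcher_mean g w A S).

(** Put Y_i = T A_i T. In the weighted average of Y_i - 1 - g(Y_i) >= 0 the Karcher equation removes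
    the terms g(Y_i). Conjugation by Q, the inverse of T, then sends Y_i to A_i and 1 to S. *)
Lemma karcher_mean_le_arith : loewner_le S (\sum_i (w i)%:C *: A i).
Proof.
have [w0 w1] := hw; have [pS] := hS.
have [Q []] := ex_sqrtmx pS; move: (invsqrtmx S) => T hT hQ TQ QQ TT karcher.
have [uT uQ] := mulmx1_unit TQ; have QT := mulmx1C TQ.
have psd : possemidefmx (\sum_i (w i)%:C *: (T *m A i *m T - 1%:M
                           - funmx g (T *m A i *m T))).
  apply: possemidefmx_sum => i; apply: possemidefmxZ; first by rewrite ltW.
  apply: classL_psd_arith => //.
  by have := posdefmx_conj uT (pA i); rewrite hT.
move: psd; under eq_bigr => i _ do rewrite scalerBr.
rewrite sumrB karcher subr0 => /(possemidefmx_conj Q).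
rewrite hQ mulmx_sumr mulmx_suml; under eq_bigr => i _ do
  rewrite -scalemxAr -scalemxAl mulmxBr mulmxBl mulmx1 QQ !mulmxA QT mul1mx
    -(mulmxA (A i)) TQ mulmx1 scalerBr.
rewrite sumrB.
by rewrite sum_weights_scalar.
Qed.

(** Here the average is of Y_i^-1 - 1 + g(Y_i) >= 0. Since Y_i^-1 = Q A_i^-1 Q, conjugation by T
    sends it to A_i^-1, and 1 to S^-1. *)
Lemma harm_le_karcher_mean :
  loewner_le (invmx S) (\sum_i (w i)%:C *: invmx (A i)).
Proof.
have [w0 w1] := hw; have [pS] := hS.
have [Q []] := ex_sqrtmx pS; move: (invsqrtmx S) => T hT hQ TQ QQ TT karcher.
have [uT uQ] := mulmx1_unit TQ; have QT := mulmx1C TQ.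
have psd : possemidefmx (\sum_i (w i)%:C *: (Q *m invmx (A i) *m Q - 1%:M
                           + funmx g (T *m A i *m T))).
  apply: possemidefmx_sum => i; apply: possemidefmxZ; first by rewrite ltW.
  rewrite -(invmx_congr TQ (posdefmx_unit (pA i))).
  apply: classL_psd_harm => //.
  by have := posdefmx_conj uT (pA i); rewrite hT.
move: psd; under eq_bigr => i _ do rewrite scalerDr -[X in _ + X]opprK.
rewrite sumrB sumrN karcher oppr0 subr0 => /(possemidefmx_conj T).
rewrite hT mulmx_sumr mulmx_suml; under eq_bigr => i _ do
  rewrite -scalemxAr -scalemxAl mulmxBr mulmxBl mulmx1 TT !mulmxA TQ mul1mx
    -(mulmxA (invmx (A i))) QT mulmx1 scalerBr.
rewrite sumrB.
by rewrite sum_weights_scalar.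
Qed.

End KarcherMean.

(** * Kantorovich-type inequalities and the two final bounds *)

Section Kantorovich.

Variable R : realType.
Local Notation C := R[i].

Lemma psd_mixed_means (k n : nat) (w : 'I_n -> R) (A : 'I_n -> 'M[C]_k)
    (m M : R) :
  (forall i, posdefmx (A i)) -> 0 < m ->
  (forall i, loewner_le (m%:C)%:M (A i) /\ loewner_le (A i) (M%:C)%:M) ->
  weight_vector w ->
  possemidefmx ((m + M)%:C%:M - \sum_i (w i)%:C *: A i
                - (m * M)%:C *: \sum_i (w i)%:C *: invmx (A i)).
Proof.
move=> pA m0 hA [w0 w1].
(* The constant is written as its own weighted average, so that the claim reduces to each [A i]
   separately. *)
rewrite -(sum_weights_scalar (m + M)%:C%:M w1) scaler_sumr -!sumrB.
apply: possemidefmx_sum => i.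
rewrite scalerA mulrC -scalerA -!scalerBr; apply: possemidefmxZ.
  by rewrite ltW.
have [herm _] := pA i; have [mA AM] := hA i.
suff -> : (m + M)%:C%:M - A i - (m * M)%:C *: invmx (A i)
    = funmx (fun t => (-1) * t + (- (m * M)) * t^-1 + (m + M)) (A i).
  apply: possemidefmx_funmx => j; set t := spec (A i) j.
  have t0 : 0 < t by exact: posdefmx_spec_gt0.
  have mt : m <= t by exact: spec_ge.
  have tM : t <= M by exact: spec_le.
  (* The sign comes from the spectrum of [A i] lying between [m] and [M]. *)
  rewrite (_ : _ + _ = (t - m) * (M - t) / t).
    by rewrite divr_ge0 ?(ltW t0) // mulr_ge0 // subr_ge0.
  by field; rewrite gt_eqF.
rewrite funmx_laurent // rmorphN1 scaleN1r rmorphN scaleNr.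
by rewrite [RHS]addrC addrA.
Qed.

(* Completing the square: K t + m M / t - (m + M)
   = (m M / t) ((m + M) t / (2 m M) - 1)^2. *)
Lemma psd_kantorovich (k : nat) (Z : 'M[C]_k) (m M : R) :
  posdefmx Z -> 0 < m -> m < M ->
  possemidefmx ((kantorovich2 (M / m))%:C *: Z + (m * M)%:C *: invmx Z
                - (m + M)%:C%:M).
Proof.
move=> pZ m0 mM; have M0 : 0 < M by exact: lt_trans mM.
rewrite (_ : _ - _ = funmx (fun t => kantorovich2 (M / m) * t
                               + m * M * t^-1 + - (m + M)) Z); last first.
  by rewrite funmx_laurent // !rmorphN.
apply: possemidefmx_funmx => j; set t := spec Z j.
have t0 : 0 < t by exact: posdefmx_spec_gt0.
rewrite (_ : _ + _ = m * M / t * ((m + M) * t / (2 * m * M) - 1) ^+ 2).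
  by rewrite mulr_ge0 ?sqr_ge0 // divr_ge0 ?mulr_ge0 // ltW.
by rewrite /kantorovich2; field; rewrite !gt_eqF.
Qed.

End Kantorovich.

Unset Implicit Arguments.

Theorem proposition2p1 (R : realType) (k n : nat) (g : R -> R)
    (w : 'I_n -> R) (A : 'I_n -> 'M[R[i]]_k) (m M : R)
    (sigma : 'M[R[i]]_k) :
  classL g ->
  (forall i, posdefmx (A i)) ->
  0 < m -> m < M ->
  (forall i, loewner_le (m%:C)%:M (A i) /\ loewner_le (A i) (M%:C)%:M) ->
  weight_vector w ->
  is_karcher_mean g w A sigma ->
  let h := M / m in
  loewner_le (\sum_(i < n) (w i)%:C *: A i) ((kantorovich2 h)%:C *: sigma) /\
  loewner_le sigma
    ((kantorovich2 h)%:C *: invmx (\sum_(i < n) (w i)%:C *: invmx (A i))).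
Proof.
move=> Lg pA m0 mM hA hw hS h.
have [pS _] := hS; have [w0 w1] := hw.
set H := \sum_i (w i)%:C *: invmx (A i).
set B := \sum_i (w i)%:C *: A i.
have mixed : possemidefmx ((m + M)%:C%:M - B - (m * M)%:C *: H).
  exact: psd_mixed_means.
have mM_ge0 : 0 <= m * M by rewrite mulr_ge0 ?ltW // (lt_trans m0).
have SB : loewner_le sigma B := karcher_mean_le_arith Lg pA hw hS.
have SH : loewner_le (invmx sigma) H := harm_le_karcher_mean Lg pA hw hS.
have pH : posdefmx H.
  apply: posdefmx_sum => [|i]; last exact/posdefmxZ/posdefmx_inv.
  (* There is at least one index, since an empty family of weights would sum to 0 instead of 1. *)
  rewrite lt0n; apply/eqP => n0; move: w1; rewrite big1.
    by move=> /esym/eqP; rewrite oner_eq0.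
  by move=> [i lt_in]; exfalso; rewrite n0 in lt_in.
split; rewrite /loewner_le.
  (* Three positive semidefinite terms telescope: the Kantorovich inequality at [sigma], the mixed
     bound on [B] and [H], and [m * M] times the gap between [H] and the inverse of [sigma]. *)
  rewrite (_ : _ - _ = ((kantorovich2 h)%:C *: sigma
      + (m * M)%:C *: invmx sigma - (m + M)%:C%:M)
      + ((m + M)%:C%:M - B - (m * M)%:C *: H)
      + (m * M)%:C *: (H - invmx sigma)).
    apply: possemidefmxD (possemidefmxZ mM_ge0 SH).
    exact: possemidefmxD (psd_kantorovich pS m0 mM) mixed.
  rewrite scalerBr; have telescope (V : zmodType) (a b c d e : V) :
      a - d = (a + b - c) + (c - d - e) + (e - b).
    by rewrite -(addrA c) (subrKA c) (addrA (a + b)) (subrKA e) addrAC addrK.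
  exact: telescope.
(* Now the Kantorovich inequality is taken at [invmx H], whose inverse cancels the [H] of the mixed
   bound, and the arithmetic bound replaces [B] by [sigma]. *)
rewrite (_ : _ - _ = ((kantorovich2 h)%:C *: invmx H
    + (m * M)%:C *: invmx (invmx H) - (m + M)%:C%:M)
    + ((m + M)%:C%:M - B - (m * M)%:C *: H) + (B - sigma)).
  apply: possemidefmxD SB.
  exact: possemidefmxD (psd_kantorovich (posdefmx_inv pH) m0 mM) mixed.
rewrite invmxK; have telescope (V : zmodType) (a b c d e : V) :
    a - e = (a + b - c) + (c - d - b) + (d - e).
  by rewrite (addrAC c) -(addrA c) (subrKA c) (addrA (a + b)) addrK (subrKA d).
exact: telescope.
Qed.
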